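(* Let $v:(-\tfrac12,\tfrac12)^2\to\mathbb R$ be the function $$v(\rho_1,\rho_2)=\frac1\pi\,\sin\psi_1\left(\frac{\sin\psi_1}{\tan\psi_2}+\sqrt{1+\frac{\sin^2\psi_1}{\tan^2\psi_2}}\right),\qquad \psi_i=(\rho_i+\tfrac12)\pi ,\ i\in\{1,2\}.$$ Then for every $\rho\in(-\tfrac12,\tfrac12)^2$ the Hessian matrix of $v$ at $\rho$ has signature $(+,-)$, i.e. one strictly positive and one strictly negative eigenvalue.
   Context: Here $1/\tan\psi_2$ is understood as $\cot\psi_2$ (so it equals $0$ at $\psi_2=\pi/2$). The function $v$ is the speed of growth $v^{\mathbb Z^2}(\rho)$ of the driven dimer dynamics on $\mathbb Z^2$ with slope $\rho\in P^{\mathbb Z^2}=(-\tfrac12,\tfrac12)^2$. *)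

(* Defs.v *)
From HB Require Import structures.
From mathcomp Require Import all_boot all_order all_algebra.
From mathcomp Require Import all_classical all_reals all_analysis.

Set Implicit Arguments.
Unset Strict Implicit.
Unset Printing Implicit Defensive.

Import Order.TTheory GRing.Theory Num.Theory.
Import numFieldNormedType.Exports.

Local Open Scope classical_set_scope.
Local Open Scope ring_scope.

Definition partial (R : realType) (n : nat) (i : 'I_n) (f : 'rV[R]_n -> R) :
  'rV[R]_n -> R := fun x => 'D_(delta_mx 0 i) f x.

(* [partial], hence [hessian], returns a default value where a derivative does
   not exist; [hessian f x] is meaningful under [twice_differentiable f x]. *)
Definition hessian (R : realType) (n : nat) (f : 'rV[R]_n -> R) (x : 'rV[R]_n) :
  'M[R]_n := \matrix_(i, j) partial i (partial j f) x.

(* Frechet sense: [f] is differentiable around [x] and its gradient is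
   differentiable at [x]. *)
Definition twice_differentiable (R : realType) (n : nat) (f : 'rV[R]_n -> R)
    (x : 'rV[R]_n) : Prop :=
  (\forall y \near x, differentiable f y) /\
  forall j : 'I_n, differentiable (partial j f) x.

Definition cot (R : realType) (x : R) : R := cos x / sin x.

Definition psi (R : realType) (r : R) : R := (r + 1 / 2) * pi.

(* 1 / tan is read as [cot], which is 0 at pi / 2. The formula is total on R^2,
   but only its values on the open square (-1/2, 1/2)^2 are meaningful; since
   the square is open, derivatives at its points depend on nothing else. *)
Definition speed (R : realType) (rho : 'rV[R]_2) : R :=
  let psi1 := psi (rho 0 0) in
  let psi2 := psi (rho 0 1) in
  1 / pi * sin psi1 *
    (sin psi1 * cot psi2 +
     Num.sqrt (1 + (sin psi1) ^+ 2 * (cot psi2) ^+ 2)).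

(* Main.v *)
Require Import Defs.
From HB Require Import structures.
From mathcomp Require Import all_boot all_order all_algebra.
From mathcomp Require Import all_classical all_reals all_analysis.
From mathcomp Require Import ring lra.

Import Order.TTheory GRing.Theory Num.Theory.
Import numFieldNormedType.Exports.

Local Open Scope classical_set_scope.
Local Open Scope ring_scope.

(** Write [s = sin psi1], [C = cos psi1], [c = cot psi2], [w = s c],
    [D = sqrt (1 + w^2)] and [E = w + D], so that the speed is [s E / pi].
    Since [E (D - w) = 1], setting [w = sinh t] gives [D = cosh t] and
    [E = exp t]: every quantity in sight is a rational function of [s], [C] and
    [E].

    The partial derivatives in [rho] are [C E^2 / D] and
    [- s^2 (1 + c^2) E / D] ([has_grad_speed]); differentiating once more gives
    the Hessian ([has_grad_speed_grad]).  Its determinant, reduced with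
    [C^2 = 1 - s^2], collapses to
    [- pi^2 (1 + c^2) s^2 E^4 (C^2 (2 D - w)^2 + s^2 D^2) / D^4]
    ([hess_det]), whose negativity is visible because [s], [D] and [E] are
    positive.  A real 2 x 2 matrix with negative determinant has a
    characteristic polynomial that is negative at 0, hence one positive and one
    negative eigenvalue ([eigenvalue_mx22_det_lt0]).

    The formulas hold on the open set [sin psi2 <> 0].  This gives
    differentiability on a neighbourhood of [rho], and it allows the partial
    derivatives of the speed to be replaced there by their closed forms before
    they are differentiated ([near_has_grad]). *)

(** * Gradients of scalar functions of several variables *)

(** Frechet differentiability is kept together with the partial derivatives:
    it is what the chain rule consumes, and both are wanted in the end. *)
Definition has_grad {R : realType} {n : nat} (f : 'rV[R]_n -> R)
    (x : 'rV[R]_n) (g : 'I_n -> R) : Prop :=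
  differentiable f x /\ forall i, partial i f x = g i.

Section Gradients.
Set Implicit Arguments.
Unset Strict Implicit.
Variables (R : realType) (n : nat).
Implicit Types (f : 'rV[R]_n -> R) (x : 'rV[R]_n) (g : 'I_n -> R).

Lemma has_grad_eq f x g1 g2 : has_grad f x g1 -> g1 =1 g2 -> has_grad f x g2.
Proof. by move=> [df fg] g12; split=> // i; rewrite fg g12. Qed.

Lemma has_grad_cst (a : R) x : has_grad (fun=> a) x (fun=> 0).
Proof.
split=> [|i]; first exact: differentiable_cst.
by rewrite /partial derive_cst.
Qed.

Lemma has_grad_coord (j : 'I_n) x :
  has_grad (fun y => y 0 j) x (fun i => (i == j)%:R).
Proof.
have dj : differentiable (fun y : 'rV[R]_n => y 0 j) x.
  exact: differentiable_coord.
split=> // i; rewrite /partial /derive.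
apply: lim_near_cst => //; near=> h.
have h0 : h != 0 by near: h; exact: nbhs_dnbhs_neq.
by rewrite /= !mxE eqxx /= addrK eq_sym /GRing.scale /= mulKf.
Unshelve. all: by end_near. Qed.

Lemma has_gradD f1 f2 x g1 g2 : has_grad f1 x g1 -> has_grad f2 x g2 ->
  has_grad (fun y => f1 y + f2 y) x (fun i => g1 i + g2 i).
Proof.
move=> [d1 e1] [d2 e2]; split=> [|i]; first exact: differentiableD.
rewrite /partial deriveD; [|exact: diff_derivable..].
by rewrite -e1 -e2.
Qed.

Lemma has_gradM f1 f2 x g1 g2 : has_grad f1 x g1 -> has_grad f2 x g2 ->
  has_grad (fun y => f1 y * f2 y) x (fun i => f1 x * g2 i + f2 x * g1 i).
Proof.
move=> [d1 e1] [d2 e2]; split=> [|i]; first exact: differentiableM.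
rewrite /partial deriveM; [|exact: diff_derivable..].
by rewrite -e1 -e2.
Qed.

Lemma has_grad_comp (phi : R -> R) (dphi : R) f x g :
  has_grad f x g -> is_derive (f x) 1 phi dphi ->
  has_grad (fun y => phi (f y)) x (fun i => dphi * g i).
Proof.
move=> [df e] [/derivable1_diffP dp dpE].
split=> [|i]; first exact: (@differentiable_comp _ _ _ _ f phi).
rewrite /partial deriveE; last exact: (@differentiable_comp _ _ _ _ f phi).
rewrite (@diff_comp _ _ _ _ f phi) //= -e /partial (deriveE _ df) -dpE.
rewrite (deriveE _ dp) -[X in 'd phi _ X = _]mulr1 [LHS]linearZ.
by rewrite mulrC.
Qed.

Lemma has_gradV f x g : f x != 0 -> has_grad f x g ->
  has_grad (fun y => (f y)^-1) x (fun i => - (f x) ^- 2 * g i).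
Proof.
move=> fx0 hf; apply: (has_grad_comp hf).
apply: is_derive_eq (is_deriveV fx0 (is_derive_id _ _)) _.
by rewrite /GRing.scale /= mulr1.
Qed.

(** Differentiability and the differential at [x] only depend on the germ of the
    function at [x], since both are determined by its first order expansion. *)
Lemma near_has_grad f1 f2 x g :
  {near x, f1 =1 f2} -> has_grad f1 x g -> has_grad f2 x g.
Proof.
move=> f12 [df e]; split=> [|i]; last first.
  by rewrite -e; apply/esym/near_eq_derive.
have cd : continuous ('d f1 x) by exact: diff_continuous.
apply/diff_locallyP; suff f2E :
    f2 \o shift x =
      cst (f2 x) + ('d f1 x : 'rV[R]_n -> R) +o_ (0 : 'rV[R]_n) id.
  by rewrite (diff_unique cd f2E).
apply/eqaddoP => eps eps0.
have /diff_locally/eqaddoP/(_ eps eps0) := df.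
move: (f12); rewrite (near_shift 0 x) => f12'; apply: filterS2 f12' => h /=.
rewrite -(nbhs_singleton f12) subr0 => fh.
rewrite -[X in `|X| <= _ -> _]/(f1 (h + x) - (f1 x + 'd f1 x h)) fh.
exact.
Qed.

End Gradients.

(** * Two by two matrices with negative determinant *)

Lemma det_mx22 (S : comNzRingType) (B : 'M[S]_2) :
  \det B = B 0 0 * B 1 1 - B 0 1 * B 1 0.
Proof.
rewrite (expand_det_row _ 0) !big_ord_recl big_ord0 /cofactor !det_mx11 !mxE.
rewrite /= addr0 expr0 expr1 mul1r mulN1r mulrN.
by congr (B _ _ * B _ _ - B _ _ * B _ _); apply/val_inj.
Qed.

(** The eigenvalues are [(tr + r) / 2] and [(tr - r) / 2], where [r] is the root
    of the discriminant [tr^2 - 4 det]; a negative determinant makes the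
    discriminant exceed [tr^2], so that [|tr| < r]. *)
Lemma eigenvalue_mx22_det_lt0 (R : rcfType) (A : 'M[R]_2) : \det A < 0 ->
  exists lam mu : R, [/\ 0 < lam, mu < 0, eigenvalue A lam & eigenvalue A mu].
Proof.
rewrite det_mx22 => detA.
have charE t : (char_poly A).[t] =
    t ^+ 2 - (A 0 0 + A 1 1) * t + (A 0 0 * A 1 1 - A 0 1 * A 1 0).
  rewrite /char_poly det_mx22 !mxE /= !mulr1n !mulr0n !sub0r.
  by rewrite !(hornerD, hornerN, hornerM, hornerX, hornerC); ring.
move: (A 0 0 + A 1 1) (A 0 0 * A 1 1 - A 0 1 * A 1 0) detA charE.
move=> tr d d_lt0 charE.
have disc_gt : tr ^+ 2 < tr ^+ 2 - 4 * d by nra.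
have disc_ge0 : 0 <= tr ^+ 2 - 4 * d.
  by apply: le_trans (ltW disc_gt); exact: sqr_ge0.
pose r := Num.sqrt (tr ^+ 2 - 4 * d).
have r2 : r ^+ 2 = tr ^+ 2 - 4 * d by rewrite sqr_sqrtr.
have : `|tr| < r.
  by rewrite -sqrtr_sqr ltr_sqrt // (le_lt_trans _ disc_gt) ?sqr_ge0.
rewrite ltr_norml => /andP[rl rr].
have root_half e : e ^+ 2 = r ^+ 2 -> eigenvalue A ((tr + e) / 2).
  rewrite eigenvalue_root_char rootE charE r2 => e2; apply/eqP.
  transitivity ((e ^+ 2 - tr ^+ 2) / 4 + d); first by field.
  by rewrite e2; field.
exists ((tr + r) / 2), ((tr - r) / 2); split; [lra | lra | exact: root_half |].
by apply: root_half; rewrite sqrrN.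
Qed.

(** * Points of the hyperbola D^2 - w^2 = 1 *)

Lemma hyperbola_mul (F : comNzRingType) (w D : F) :
  D ^+ 2 = 1 + w ^+ 2 -> (w + D) * (D - w) = 1.
Proof. by move=> D2; rewrite mulrC [w + D]addrC -subr_sqr D2 addrK. Qed.

(** The two factors of [(w + D) (D - w) = 1] have the same sign, and their sum
    is [2 D]. *)
Lemma hyperbola_gt0 (F : realFieldType) (w D : F) :
  0 < D -> D ^+ 2 = 1 + w ^+ 2 -> 0 < w + D.
Proof.
move=> D0 D2; rewrite ltNge; apply/negP => wD_le0.
have Dw_ge0 : 0 <= D - w by lra.
by have := mulr_le0_ge0 wD_le0 Dw_ge0; rewrite hyperbola_mul // ler10.
Qed.

(** * First and second derivatives of the speed *)

Section Speed.

Variable R : realType.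
Implicit Types (y : 'rV[R]_2) (i j : 'I_2) (s c C D : R).

(** With [w = sn y * ct y] one has [hyp y = cosh t] where [w = sinh t], so
    [speed y = sn y * (w + hyp y) / pi = sn y * exp t / pi]. *)
Definition sn y : R := sin (psi (y 0 0)).
Definition cs y : R := cos (psi (y 0 0)).
Definition ct y : R := cot (psi (y 0 1)).
Definition hyp y : R := Num.sqrt (1 + sn y ^+ 2 * ct y ^+ 2).

Lemma is_derive_psi (r : R) : is_derive r 1 (@psi R) pi.
Proof.
have -> : @psi R = pi \*: (id + cst (1 / 2)).
  by apply/funext => t; rewrite /psi mulrC.
by apply: is_derive_eq; rewrite addr0 /GRing.scale /= mulr1.
Qed.

Lemma has_grad_psi j y :
  has_grad (fun y => psi (y 0 j)) y (fun i => pi * (i == j)%:R).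
Proof. exact: has_grad_comp (has_grad_coord j y) (is_derive_psi _). Qed.

Lemma has_grad_sn y : has_grad sn y (fun i => pi * cs y * (i == 0)%:R).
Proof.
apply: has_grad_eq (has_grad_comp (has_grad_psi 0 y) (is_derive_sin _)) _ => i.
by rewrite /cs; ring.
Qed.

Lemma has_grad_cs y : has_grad cs y (fun i => - pi * sn y * (i == 0)%:R).
Proof.
apply: has_grad_eq (has_grad_comp (has_grad_psi 0 y) (is_derive_cos _)) _ => i.
by rewrite /sn; ring.
Qed.

Lemma has_grad_ct y : sin (psi (y 0 1)) != 0 ->
  has_grad ct y (fun i => - pi * (1 + ct y ^+ 2) * (i == 1)%:R).
Proof.
move=> s0; rewrite /ct /cot.
have hs := has_grad_comp (has_grad_psi 1 y) (is_derive_sin _).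
have hc := has_grad_comp (has_grad_psi 1 y) (is_derive_cos _).
apply: has_grad_eq (has_gradM hc (has_gradV s0 hs)) _ => i /=.
by field.
Qed.

Lemma hyp_gt0 y : 0 < hyp y.
Proof. by rewrite sqrtr_gt0 ltr_pwDl // mulr_ge0 ?sqr_ge0. Qed.

Lemma sqr_hyp y : hyp y ^+ 2 = 1 + (sn y * ct y) ^+ 2.
Proof. by rewrite exprMn sqr_sqrtr // addr_ge0 // mulr_ge0 ?sqr_ge0. Qed.

Lemma has_grad_hyp y : sin (psi (y 0 1)) != 0 ->
  has_grad hyp y (fun i => pi * sn y * ct y *
    (cs y * ct y * (i == 0)%:R - sn y * (1 + ct y ^+ 2) * (i == 1)%:R) / hyp y).
Proof.
move=> s0.
have hs := has_grad_sn y; have hc := has_grad_ct s0.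
have hw := has_gradM (has_gradM hs hs) (has_gradM hc hc).
have hr := has_gradD (has_grad_cst 1 y) hw.
have Hp : 0 < 1 + sn y * sn y * (ct y * ct y).
  by apply: ltr_pwDl => //; rewrite -!expr2 mulr_ge0 ?sqr_ge0.
have D0 : hyp y != 0 by rewrite gt_eqF ?hyp_gt0.
apply: has_grad_eq (has_grad_comp hr (is_derive1_sqrt Hp)) _ => i /=.
rewrite -!expr2 -/(hyp y).
by field.
Qed.

Definition speed_grad y j : R :=
  cs y * (sn y * ct y + hyp y) ^+ 2 / hyp y * (j == 0)%:R
  - sn y ^+ 2 * (1 + ct y ^+ 2) * (sn y * ct y + hyp y) / hyp y * (j == 1)%:R.

Lemma has_grad_speed y : sin (psi (y 0 1)) != 0 ->
  has_grad (@speed R) y (speed_grad y).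
Proof.
move=> s0.
have hs := has_grad_sn y; have hc := has_grad_ct s0; have hh := has_grad_hyp s0.
have D0 : hyp y != 0 by rewrite gt_eqF ?hyp_gt0.
have pi0 : pi != 0 :> R by rewrite gt_eqF ?pi_gt0.
have := has_gradM (has_gradM (has_grad_cst (1 / pi) y) hs)
                  (has_gradD (has_gradM hs hc) hh).
move/has_grad_eq; apply => i; rewrite /speed_grad.
(* [field] would otherwise unfold [pi], which is twice a chosen zero of [cos]. *)
by move: (pi : R) pi0 => p p0; field; rewrite D0.
Qed.

(** The second order partial derivatives as functions of [s = sin psi1],
    [c = cot psi2], [C = cos psi1] and [D = sqrt (1 + (s c)^2)].  The product
    [(s c + D) (D - s c)] in [hess11] equals 1; it is the form in which the
    derivative of [E / D] with respect to [w = s c] comes out of the quotient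
    rule, as [E (D - w) / D^3]. *)
Definition hess00 s c C D : R :=
  pi * (- s * (s * c + D) ^+ 2 / D
        + C ^+ 2 * c * (s * c + D) ^+ 2 * (2 * D - s * c) / D ^+ 3).
Definition hess01 s c C D : R :=
  - pi * C * s * (1 + c ^+ 2) * (s * c + D) ^+ 2 * (2 * D - s * c) / D ^+ 3.
Definition hess11 s c D : R :=
  pi * s ^+ 2 * (1 + c ^+ 2) * (2 * c * (s * c + D) / D
        + s * (1 + c ^+ 2) * (s * c + D) * (D - s * c) / D ^+ 3).

Definition speed_hess y j i : R :=
  let h00 := hess00 (sn y) (ct y) (cs y) (hyp y) in
  let h01 := hess01 (sn y) (ct y) (cs y) (hyp y) in
  let h11 := hess11 (sn y) (ct y) (hyp y) in
  (h00 * (j == 0)%:R + h01 * (j == 1)%:R) * (i == 0)%:R +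
  (h01 * (j == 0)%:R + h11 * (j == 1)%:R) * (i == 1)%:R.

Lemma has_grad_speed_grad y j : sin (psi (y 0 1)) != 0 ->
  has_grad (speed_grad ^~ j) y (speed_hess y j).
Proof.
move=> s0.
have hs := has_grad_sn y; have hc := has_grad_ct s0; have hh := has_grad_hyp s0.
have hC := has_grad_cs y.
have D0 : hyp y != 0 by rewrite gt_eqF ?hyp_gt0.
have hV := has_gradV D0 hh.
have hE := has_gradD (has_gradM hs hc) hh.
have h0 := has_gradM (has_gradM hC (has_gradM hE hE)) hV.
have hq := has_gradD (has_grad_cst 1 y) (has_gradM hc hc).
have h1 := has_gradM (has_gradM (has_gradM (has_gradM hs hs) hq) hE) hV.
have H := has_gradD (has_gradM h0 (has_grad_cst (j == 0)%:R y))
            (has_gradM h1 (has_grad_cst (- (j == 1)%:R) y)).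
apply: near_has_grad (has_grad_eq H _) => [|i].
  by apply: filterE => z; rewrite /speed_grad; ring.
rewrite /speed_hess /hess00 /hess01 /hess11.
by field.
Qed.

(** After the substitutions [D = (E + E^-1) / 2] and [s c = (E - E^-1) / 2],
    with [C^2] replaced by [1 - s^2], this is an identity between rational
    functions of the independent variables [s] and [E]. *)
Lemma hess_det s c C D : 0 < s -> 0 < D ->
  C ^+ 2 = 1 - s ^+ 2 -> D ^+ 2 = 1 + (s * c) ^+ 2 ->
  hess00 s c C D * hess11 s c D - hess01 s c C D ^+ 2 =
  - (pi ^+ 2 * (1 + c ^+ 2) * s ^+ 2 * (s * c + D) ^+ 4 *
     (C ^+ 2 * (2 * D - s * c) ^+ 2 + s ^+ 2 * D ^+ 2) / D ^+ 4).
Proof.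
move=> /lt0r_neq0 s0 D0 C2 D2; rewrite /hess00 /hess01 /hess11.
have EE := hyperbola_mul D2; have E0 := lt0r_neq0 (hyperbola_gt0 D0 D2).
set E := s * c + D in EE E0 *.
have E1 : D - s * c = E^-1 by rewrite -[LHS](mulKf E0) EE mulr1.
have DE : D = (E + E^-1) / 2 by rewrite -E1 /E; field.
have cE : c = (E - E^-1) / (2 * s) by rewrite -E1 /E; field.
clearbody E.
have E20 : E ^+ 2 + 1 != 0 by rewrite gt_eqF // ltr_wpDl ?sqr_ge0.
rewrite !exprMn C2 DE cE; field.
by rewrite -expr2 s0 E0 E20.
Qed.

Lemma near_sin_psi_neq0 y : sin (psi (y 0 1)) != 0 ->
  \forall z \near y, sin (psi ((z : 'rV[R]_2) 0 1)) != 0.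
Proof.
move=> s0; apply: (@cvgr_neq0 _ _ _ (nbhs y) _ _ (sin (psi (y 0 1)))) => //.
have [ds _] := has_grad_comp (has_grad_psi 1 y) (is_derive_sin _).
exact: (differentiable_continuous ds).
Qed.

Lemma has_grad_partial_speed y j : sin (psi (y 0 1)) != 0 ->
  has_grad (partial j (@speed R)) y (speed_hess y j).
Proof.
move=> s0; apply: near_has_grad (has_grad_speed_grad j s0).
by apply: filterS (near_sin_psi_neq0 s0) => z /has_grad_speed[_ ->].
Qed.

Lemma det_hessian_speed_lt0 y : 0 < sin (psi (y 0 0)) ->
  sin (psi (y 0 1)) != 0 -> \det (hessian (@speed R) y) < 0.
Proof.
move=> s0 s1.
(* [hessian _ i j] differentiates in direction [j] first, then [i]. *)
have hE i j : hessian (@speed R) y i j = speed_hess y j i.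
  by rewrite mxE; have [_ ->] := has_grad_partial_speed j s1.
rewrite det_mx22 !hE /speed_hess /= !(mulr0, mulr1, addr0, add0r) -expr2.
have D0 := hyp_gt0 y; have D2 := sqr_hyp y.
rewrite (@hess_det (sn y) _ (cs y) _ s0 D0 (cos2sin2 _) D2) oppr_lt0.
have E0 := hyperbola_gt0 D0 D2.
rewrite divr_gt0 ?exprn_gt0 // !mulr_gt0 ?exprn_gt0 ?pi_gt0 //.
  by rewrite ltr_pwDl ?sqr_ge0.
by apply: ltr_wpDl; rewrite -exprMn ?sqr_ge0 // exprn_gt0 ?mulr_gt0.
Qed.

End Speed.

(** * The signature of the Hessian *)

Theorem mainTheorem3 (R : realType) (rho : 'rV[R]_2)
    (hrho : forall i : 'I_2, - (1 / 2) < rho 0 i < 1 / 2) :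
  twice_differentiable (@speed R) rho /\
  exists lam mu : R,
    [/\ 0 < lam, mu < 0, eigenvalue (hessian (@speed R) rho) lam
      & eigenvalue (hessian (@speed R) rho) mu].
Proof.
have sin_gt0 i : 0 < sin (psi (rho 0 i)).
  have pi0 := pi_gt0 R; have /andP[lo hi] := hrho i.
  by apply: sin_gt0_pi; rewrite /psi; apply/andP; split; nra.
have s1 : sin (psi (rho 0 1)) != 0 by rewrite gt_eqF.
split; last exact/eigenvalue_mx22_det_lt0/det_hessian_speed_lt0.
split=> [|j]; last by have [] := has_grad_partial_speed j s1.
by apply: filterS (near_sin_psi_neq0 s1) => y /has_grad_speed[].
Qed.
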